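(* Let $K$ be a non-Archimedean local field of characteristic $p>0$ whose residue field has cardinality $q$, and let $f\in\mathcal{A}_K[1,1]$ be not special. Let $M$ be the number of zeroes (counted with multiplicity) of absolute value $1$ in $\Omega_K$ of the Laurent series $f(X)^q-f(X^q)$. Then $$\#\{\zeta\in\mu_\infty: f(\zeta)\in\mu_\infty\}\le M.$$
   Context: $\Omega_K$ is the completion of an algebraic closure of $K$ with respect to the extension of the absolute value $|\cdot|$ of $K$ (it is algebraically closed); $\mu_\infty$ is the group of roots of unity in $\Omega_K$. $\mathcal{A}_K[1,1]$ is the set of Laurent series $\sum_{n\in\mathbb{Z}}f_nX^n$ with $f_n\in K$ and $|f_n|\to0$ as $|n|\to\infty$. In characteristic $p$, $f$ is special if $f\in\overline{\mathbb{F}}_p[X,X^{-1}]$. *)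

(* Defs.v *)
From HB Require Import structures.
From mathcomp Require Import all_boot all_order all_algebra.
From mathcomp Require Import reals.
Set Implicit Arguments. Unset Strict Implicit. Unset Printing Implicit Defensive.
Import Order.TTheory GRing.Theory Num.Theory.
Local Open Scope ring_scope.

Section Defs.
Variable R : realType.

Definition is_absval (F : fieldType) (v : F -> R) : Prop :=
  [/\ forall x, 0 <= v x, forall x, (v x == 0) = (x == 0),
      forall x y, v (x * y) = v x * v y &
      forall x y, v (x + y) <= v x + v y].

Definition nonarch (F : fieldType) (v : F -> R) : Prop :=
  forall x y, v (x + y) <= Num.max (v x) (v y).

Definition vcauchy (F : fieldType) (v : F -> R) (u : nat -> F) : Prop :=
  forall e : R, 0 < e -> exists N : nat, forall m n : nat,
    (N <= m)%N -> (N <= n)%N -> v (u m - u n) < e.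

Definition vconv (F : fieldType) (v : F -> R) (u : nat -> F) (l : F) : Prop :=
  forall e : R, 0 < e -> exists N : nat, forall n : nat,
    (N <= n)%N -> v (u n - l) < e.

Definition vcomplete (F : fieldType) (v : F -> R) : Prop :=
  forall u, vcauchy v u -> exists l, vconv v u l.

Definition residue_card (K : fieldType) (v : K -> R) (q : nat) : Prop :=
  exists r : seq K,
    [/\ size r = q, all (fun x => v x <= 1) r,
        pairwise (fun x y => ~~ (v (x - y) < 1)) r &
        forall x, v x <= 1 -> has (fun y => v (x - y) < 1) r].

Definition local_field_charp (K : fieldType) (v : K -> R) (p q : nat) : Prop :=
  [/\ is_absval v /\ nonarch v, vcomplete v,
      prime p /\ p \in [pchar K],
      (exists pi : K, (0 < v pi < 1) /\
          forall x, x != 0 -> exists z : int, v x = v pi ^ z)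
    & residue_card v q].

Definition algebraic_over (K : fieldType) (Om : fieldType)
  (iota : {rmorphism K -> Om}) (z : Om) : Prop :=
  exists P : {poly K}, P != 0 /\ root (map_poly iota P) z.

Definition completed_alg_closure (K : fieldType) (v : K -> R)
  (Om : closedFieldType) (w : Om -> R) (iota : {rmorphism K -> Om}) : Prop :=
  [/\ is_absval w, nonarch w, vcomplete w,
      forall x, w (iota x) = v x &
      forall y e, 0 < e -> exists z, algebraic_over iota z /\ w (y - z) < e].

(** Laurent series sum_{n in Z} f_n X^n with |f_n| -> 0 as |n| -> oo. *)
Definition in_A11 (F : fieldType) (v : F -> R) (f : int -> F) : Prop :=
  forall e : R, 0 < e -> exists N : nat, forall n : int,
    (N <= `|n|)%N -> v (f n) < e.

Definition lpsum (F : fieldType) (f : int -> F) (x : F) (N : nat) : F :=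
  \sum_(i < N.*2.+1) f (i%:Z - N%:Z) * x ^ (i%:Z - N%:Z).

Definition laurent_value (F : fieldType) (v : F -> R) (f : int -> F) (x l : F) : Prop :=
  vconv v (lpsum f x) l.

Definition is_lprod (F : fieldType) (v : F -> R) (a b c : int -> F) : Prop :=
  forall n : int,
    vconv v (fun N => \sum_(i < N.*2.+1)
                        a (i%:Z - N%:Z) * b (n - (i%:Z - N%:Z))) (c n).

Fixpoint is_lpow (F : fieldType) (v : F -> R) (a : int -> F) (k : nat)
  (c : int -> F) : Prop :=
  match k with
  | 0 => c = (fun n => (n == 0)%:R)
  | k'.+1 => exists d, is_lpow v a k' d /\ is_lprod v d a c
  end.

(** Multiplication of a Laurent series by (X - a). *)
Definition lmulXa (F : fieldType) (a : F) (h : int -> F) : int -> F :=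
  fun n => h (n - 1) - a * h n.

Definition zero_mult (F : fieldType) (v : F -> R) (g : int -> F) (a : F)
  (m : nat) : Prop :=
  exists h : int -> F, [/\ in_A11 v h, g = iter m (lmulXa a) h &
    exists l, laurent_value v h a l /\ l != 0].

End Defs.

Definition mu_infty_mem (F : fieldType) (z : F) : Prop :=
  exists n : nat, (0 < n)%N /\ z ^+ n = 1.

Definition alg_over_Fp (p : nat) (K : fieldType) (x : K) : Prop :=
  exists P : {poly 'F_p}, P != 0 /\
    root (map_poly (fun a : 'F_p => (nat_of_ord a)%:R : K) P) x.

Definition special_laurent (p : nat) (K : fieldType) (f : int -> K) : Prop :=
  (exists N : nat, forall n : int, (N < `|n|)%N -> f n = 0) /\
  (forall n, alg_over_Fp p (f n)).

(* Main.v *)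
Require Import Defs.
From HB Require Import structures.
From mathcomp Require Import all_boot all_order all_algebra.
From mathcomp Require Import all_fingroup all_solvable.
From mathcomp Require Import boolp reals.
From mathcomp Require Import zify ring lra.
Import Order.TTheory GRing.Theory Num.Theory.
Set Implicit Arguments.
Unset Strict Implicit.
Unset Printing Implicit Defensive.
Local Open Scope ring_scope.

(** Since q is a power of p, f(X)^q - f(X^q) = G(X^q) with G_n = f_n^q - f_n; it
    vanishes identically only if every f_n lies in F_q, in which case f is
    special.  It therefore suffices that every root of unity z such that
    l = f(z) is a root of unity satisfies f(z^q) = l^q: then z is a zero, and
    distinct z give distinct zeros.  Let u, u_i be roots of unity (or 0) and a_i
    in K.  Expanding the a_i in powers of a uniformizer with Teichmuller digits
    shows |sum a_i u_i| = |sum a_i u_i^q|, because the combination of the digits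
    of a given level is 0 or a unit, and its q-th power is obtained by raising
    the u_i to the q-th power.  Applied to the partial sums of f(z) - l, which
    tend to 0, this gives f(z^q) = l^q.  Multiplicities are finite because
    dividing by X - z shrinks the interval between the first and the last
    coefficient of maximal absolute value. *)

(** * Non-Archimedean absolute values *)

Section Absval.
Variables (R : realType) (F : fieldType) (v : F -> R).
Hypotheses (av : is_absval v) (na : nonarch v).

Lemma absval_ge0 x : 0 <= v x. Proof. by case: av. Qed.

Lemma absval_eq0 x : (v x == 0) = (x == 0). Proof. by case: av. Qed.

Lemma absval_gt0 x : (0 < v x) = (x != 0).
Proof. by rewrite lt_def absval_ge0 andbT absval_eq0. Qed.

Lemma absvalM x y : v (x * y) = v x * v y. Proof. by case: av. Qed.

Lemma absval0 : v 0 = 0. Proof. by apply/eqP; rewrite absval_eq0. Qed.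

Lemma absval1 : v 1 = 1.
Proof.
have v1 : v 1 != 0 by rewrite absval_eq0 oner_eq0.
by apply: (mulfI v1); rewrite -absvalM !mulr1.
Qed.

Lemma absvalX x n : v (x ^+ n) = v x ^+ n.
Proof. by elim: n => [|n IH]; rewrite ?expr0 ?absval1 // !exprS absvalM IH. Qed.

Lemma absval_unity_root n z : (0 < n)%N -> z ^+ n = 1 -> v z = 1.
Proof.
move=> n0 zn; apply/eqP.
by rewrite -(@pexpr_eq1 _ (v z) n) ?absval_ge0 // -absvalX zn absval1.
Qed.

Lemma absvalN x : v (- x) = v x.
Proof.
rewrite -mulN1r absvalM (@absval_unity_root 2 (-1)) ?mul1r //.
by rewrite sqrrN expr1n.
Qed.

Lemma absvalV x : v x^-1 = (v x)^-1.
Proof.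
have [->|x0] := eqVneq x 0; first by rewrite invr0 absval0 invr0.
have vx : v x != 0 by rewrite absval_eq0.
by apply: (mulfI vx); rewrite -absvalM !divff // absval1.
Qed.

Lemma absval_exprz1 z (n : int) : v z = 1 -> v (z ^ n) = 1.
Proof.
move=> vz; case: n => n; rewrite ?NegzE ?exprz_inv /=.
  by rewrite -exprnP absvalX vz expr1n.
by rewrite -exprnN absvalV absvalX vz expr1n invr1.
Qed.

Lemma absvalBC x y : v (x - y) = v (y - x).
Proof. by rewrite -opprB absvalN. Qed.

Lemma absvalD_le c x y : v x <= c -> v y <= c -> v (x + y) <= c.
Proof. by move=> xc yc; apply: le_trans (na x y) _; rewrite ge_max xc. Qed.

Lemma absvalD_lt c x y : v x < c -> v y < c -> v (x + y) < c.
Proof. by move=> xc yc; apply: le_lt_trans (na x y) _; rewrite gt_max xc. Qed.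

Lemma absvalB_le c x y : v x <= c -> v y <= c -> v (x - y) <= c.
Proof. by move=> xc yc; apply: absvalD_le; rewrite ?absvalN. Qed.

Lemma absvalB_lt c x y : v x < c -> v y < c -> v (x - y) < c.
Proof. by move=> xc yc; apply: absvalD_lt; rewrite ?absvalN. Qed.

Lemma absval_chain_le c y x z : v (x - y) <= c -> v (y - z) <= c -> v (x - z) <= c.
Proof. by move=> xy yz; rewrite -(subrKA y); apply: absvalD_le. Qed.

Lemma absval_chain_lt c y x z : v (x - y) < c -> v (y - z) < c -> v (x - z) < c.
Proof. by move=> xy yz; rewrite -(subrKA y); apply: absvalD_lt. Qed.

Lemma absval_sum_le (I : Type) (r : seq I) (P : pred I) (E : I -> F) c :
  0 <= c -> (forall i, P i -> v (E i) <= c) -> v (\sum_(i <- r | P i) E i) <= c.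
Proof.
move=> c0 Ec; elim/big_ind: _ => [|x y|//]; first by rewrite absval0.
exact: absvalD_le.
Qed.

(** Writing x = (x + y) - y, a drop of |x + y| below |x| would give |x| < |x|. *)
Lemma absvalD_dom x y : v y < v x -> v (x + y) = v x.
Proof.
move=> yx; apply/eqP; rewrite eq_le absvalD_le ?(ltW yx) //=.
rewrite leNgt; apply/negP => xyx.
have := absvalB_lt xyx yx; rewrite addrK ltxx; exact: notF.
Qed.

(** Congruence modulo the maximal ideal is multiplicative on the valuation ring. The bound on the
    product is carried through the induction because each new factor multiplies an error by it. *)
Lemma absval_prod_congr (I : Type) (r : seq I) (P : pred I) (E E' : I -> F) :
  (forall i, P i -> v (E i) <= 1) -> (forall i, P i -> v (E' i) <= 1) ->
  (forall i, P i -> v (E i - E' i) < 1) ->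
  v (\prod_(i <- r | P i) E i - \prod_(i <- r | P i) E' i) < 1.
Proof.
move=> E1 E'1 EE'.
have: v (\prod_(i <- r | P i) E i) <= 1 /\
    v (\prod_(i <- r | P i) E i - \prod_(i <- r | P i) E' i) < 1; last by case.
elim: r => [|i r [IH1 IH2]]; first by rewrite !big_nil subrr absval0 absval1.
rewrite !big_cons; case: ifP => // Pi; split.
  by rewrite absvalM mulr_ile1 ?absval_ge0 ?E1.
set x := \prod_(j <- r | P j) E j in IH1 IH2 *.
set y := \prod_(j <- r | P j) E' j in IH1 IH2 *.
have -> : E i * x - E' i * y = (E i - E' i) * x + E' i * (x - y) by ring.
apply: absvalD_lt; rewrite absvalM.
  by rewrite (le_lt_trans _ (EE' i Pi)) // ler_piMr ?absval_ge0.
by rewrite (le_lt_trans _ IH2) // ler_piMl ?absval_ge0 ?E'1.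
Qed.

(** If |l - x| exceeded c, a term u_N close enough to l would satisfy |u_N - x| = |l - x| > c. *)
Lemma vconv_le u l x c : vconv v u l ->
  (exists N, forall n, (N <= n)%N -> v (u n - x) <= c) -> v (l - x) <= c.
Proof.
move=> ul [N uN]; have c0 := le_trans (absval_ge0 _) (uN N (leqnn N)).
rewrite leNgt; apply/negP => lxc.
have [M uM] := ul _ (le_lt_trans c0 lxc).
have lu := uM _ (leq_maxr N M); rewrite absvalBC in lu.
have := uN _ (leq_maxl N M).
have -> : u (maxn N M) - x = (l - x) - (l - u (maxn N M)) by ring.
by rewrite absvalD_dom ?absvalN // leNgt lxc.
Qed.

Lemma vconv_uniq u l l' : vconv v u l -> vconv v u l' -> l = l'.
Proof.
move=> ul ul'; apply/eqP; rewrite -subr_eq0 -absval_eq0 eq_le absval_ge0 andbT.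
apply/ler_addgt0Pl => e e0; rewrite addr0; apply: (vconv_le ul).
by have [N uN] := ul' e e0; exists N => n /uN /ltW.
Qed.

(** In the ultrametric setting |u_(n+k) - u_n| is at most the largest step in between, so vanishing
    steps already make the sequence Cauchy. *)
Lemma cvg_of_steps u : vcomplete v ->
  (forall e, 0 < e -> exists N, forall n, (N <= n)%N -> v (u n.+1 - u n) < e) ->
  exists l, vconv v u l.
Proof.
move=> vc ustep; apply: vc => e e0.
have [N uN] := ustep e e0; exists N.
have uk n k : (N <= n)%N -> v (u (n + k)%N - u n) < e.
  move=> Nn; elim: k => [|k IH]; first by rewrite addn0 subrr absval0.
  by apply: absval_chain_lt IH; rewrite addnS uN // (leq_trans Nn) ?leq_addr.
move=> m n Nm Nn; have [mn|/ltnW nm] := leqP m n.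
  by rewrite absvalBC -(subnKC mn) uk.
by rewrite -(subnKC nm) uk.
Qed.

(** Bernoulli's inequality for x^-1 = 1 + y gives x^-n >= 1 + n y, which exceeds 1/e once n >= 1/(e
    y). *)
Lemma exp_lt_eps (x e : R) : 0 <= x < 1 -> 0 < e ->
  exists N, forall n, (N <= n)%N -> x ^+ n < e.
Proof.
move=> /andP[x0 x1] e0.
have [->|xn0] := eqVneq x 0.
  by exists 1%N => -[] // n _; rewrite expr0n.
have xp : 0 < x by rewrite lt_def xn0.
have y0 : 0 < x^-1 - 1 by rewrite subr_gt0 invf_gt1.
set y := x^-1 - 1 in y0.
have bernoulli n : 1 + n%:R * y <= x^-1 ^+ n.
  elim: n => [|n IH]; first by rewrite mul0r addr0.
  have xE : x^-1 = 1 + y by rewrite subrKC.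
  rewrite exprS {1}xE; have y1 : 0 <= 1 + y by rewrite ltW // addr_gt0.
  apply: le_trans (ler_wpM2l y1 IH).
  rewrite -natr1 -subr_ge0.
  have -> : (1 + y) * (1 + n%:R * y) - (1 + (n%:R + 1) * y) = n%:R * y ^+ 2.
    by ring.
  by rewrite mulr_ge0 ?sqr_ge0.
exists (Num.bound ((e * y)^-1)) => n Nn.
rewrite -ltf_pV2 ?posrE ?exprn_gt0 // -exprVn.
apply: lt_le_trans (bernoulli n); rewrite -subr_gt0 -addrA.
have /lt_le_trans/(_ (_ : _ <= n%:R)) : (e * y)^-1 < (Num.bound (e * y)^-1)%:R.
  by apply: archi_boundP; rewrite invr_ge0 mulr_ge0 ?ltW.
rewrite ler_nat => /(_ Nn); rewrite invfM ltr_pdivrMr // => eyn.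
by rewrite addr_gt0 // subr_gt0.
Qed.

End Absval.

(** * The residue field *)

Section ResidueClasses.
Variables (R : realType) (K : fieldType) (v : K -> R) (n : nat) (r : seq K).
Hypotheses (av : is_absval v) (na : nonarch v).
Hypotheses (size_r : size r = n.+1) (r1 : all (fun x => v x <= 1) r).
Hypothesis rsep : pairwise (fun x y => ~~ (v (x - y) < 1)) r.
Hypothesis rcov : forall x, v x <= 1 -> has (fun y => v (x - y) < 1) r.

Definition class_rep (i : 'I_n.+1) : K := r`_i.

(** Residue classes are modelled by positions in [r]; the default of [inord] is reached only outside
    the valuation ring. *)
Definition class_of (x : K) : 'I_n.+1 := inord (find (fun y => v (x - y) < 1) r).

Local Notation rep := class_rep.
Local Notation cls := class_of.

Lemma class_rep_le1 i : v (rep i) <= 1.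
Proof. by apply: (all_nthP _ r1); rewrite size_r. Qed.

Lemma class_ofP x : v x <= 1 -> v (x - rep (cls x)) < 1.
Proof.
move=> /rcov hx; rewrite /rep /cls inordK ?(nth_find 0 hx) //.
by rewrite -size_r -has_find.
Qed.

Lemma class_rep_inj i j : v (rep i - rep j) < 1 -> i = j.
Proof.
move/(pairwiseP 0): rsep; rewrite size_r => sep ij.
case: (ltngtP i j) => [lij|lji|/val_inj //].
  by have := sep i j (ltn_ord i) (ltn_ord j) lij; rewrite -/(rep _) ij.
by have := sep j i (ltn_ord j) (ltn_ord i) lji; rewrite -/(rep _) absvalBC // ij.
Qed.

Lemma residue_card_gt1 : (0 < n)%N.
Proof.
rewrite lt0n; apply/negP => /eqP n0.
have c1 : v (1 - rep (cls 1)) < 1 by rewrite class_ofP ?absval1.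
have c0 : v (0 - rep (cls 0)) < 1 by rewrite class_ofP ?absval0.
have cE : cls 1 = cls 0.
  by apply/val_inj => /=; have := ltn_ord (cls 1); have := ltn_ord (cls 0); lia.
rewrite cE in c1; rewrite absvalBC // in c0.
by have := absval_chain_lt na c1 c0; rewrite subr0 absval1 ?ltxx.
Qed.

(* Lagrange: multiplication by a unit permutes the nonzero residue classes. *)
Lemma residue_expE x : v x <= 1 -> v (x ^+ n.+1 - x) < 1.
Proof.
move=> x1; have [xlt|] := boolP (v x < 1).
  by apply: (absvalB_lt av na) => //; rewrite absvalX // exprn_ilt1 ?absval_ge0.
rewrite -leNgt => x1'; have vx : v x = 1 by apply/le_anti/andP.
have vxM y : v (x * y) = v y by rewrite absvalM // vx mul1r.
pose i0 := cls 0.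
have z0 : v (rep i0) < 1.
  by rewrite -(absvalN av) -sub0r class_ofP ?absval0.
have nz i : (v (rep i) < 1) = (i == i0).
  apply/idP/eqP => [vi|-> //]; apply: class_rep_inj.
  exact: (absvalB_lt av na).
pose m i := cls (x * rep i).
have xr1 i : v (x * rep i) <= 1 by rewrite vxM class_rep_le1.
have m_inj : injective m.
  move=> i j mij; apply: class_rep_inj; rewrite -vxM mulrBr.
  apply: (absval_chain_lt na (class_ofP (xr1 i))).
  by rewrite -/(m i) mij absvalBC // class_ofP.
have m0 i : (m i != i0) = (i != i0).
  rewrite -!nz; congr (~~ _).
  have c := class_ofP (xr1 i); rewrite -/(m i) in c.
  rewrite -(vxM (rep i)); apply/idP/idP => h.
    by rewrite -(subrK (rep (m i)) (x * _)) (absvalD_lt na).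
  by rewrite -(subKr (x * rep i) (rep (m i))) (absvalB_lt av na).
(* This product over the n nonzero classes is a unit; reindexing it by [m] extracts a factor x^n,
   whence x^n = 1 in the residue field. *)
pose Pr := \prod_(i | i != i0) rep i.
have vPr : v Pr = 1.
  rewrite /Pr; elim/big_ind: _ => [|a b|i]; rewrite ?absval1 ?absvalM //.
    by move=> -> ->; rewrite mulr1.
  by rewrite -nz -leNgt => ri; apply/le_anti; rewrite class_rep_le1.
have xPr : v (x ^+ n * Pr - Pr) < 1.
  have -> : x ^+ n * Pr = \prod_(i | i != i0) (x * rep i).
    rewrite big_split prodr_const /=; congr (_ ^+ _ * _).
    by have := cardC1 i0; rewrite card_ord.
  have PrE : Pr = \prod_(i | i != i0) rep (m i).
    rewrite /Pr (reindex_inj m_inj) /=; apply: eq_bigl => i; exact: m0.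
  rewrite [X in _ - X]PrE.
  by apply: absval_prod_congr => // i _; rewrite ?class_rep_le1 ?class_ofP.
rewrite exprS -[X in _ - X]mulr1 -mulrBr vxM.
move: xPr; have -> : x ^+ n * Pr - Pr = (x ^+ n - 1) * Pr by ring.
by rewrite absvalM // vPr mulr1.
Qed.

(* The hypotheses are phantom arguments, from which the group laws below are
   inferred. *)
Definition residue_group (_ : is_absval v) (_ : nonarch v) (_ : size r = n.+1)
  (_ : all (fun x => v x <= 1) r)
  (_ : pairwise (fun x y => ~~ (v (x - y) < 1)) r)
  (_ : forall x, v x <= 1 -> has (fun y => v (x - y) < 1) r) := 'I_n.+1.

Local Notation G := (residue_group av na size_r r1 rsep rcov).

HB.instance Definition _ := Finite.on G.

Definition residue_add (i j : G) : G := cls (rep i + rep j).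
Definition residue_opp (i : G) : G := cls (- rep i).

Lemma residue_addP i j : v (rep (residue_add i j) - (rep i + rep j)) < 1.
Proof.
by rewrite absvalBC // class_ofP // (absvalD_le na) ?class_rep_le1.
Qed.

Lemma residue_addA : associative residue_add.
Proof.
move=> i j k; apply: class_rep_inj.
apply: (absval_chain_lt na (residue_addP _ _)).
apply: (@absval_chain_lt _ _ _ na _ (rep i + rep j + rep k)).
  by rewrite -[rep i + _ + _]addrA [rep i + _]addrC [rep i + (rep j + _)]addrC
    opprD addrACA subrr addr0 residue_addP.
rewrite absvalBC //; apply: (absval_chain_lt na (residue_addP _ _)).
by rewrite opprD addrACA subrr addr0 residue_addP.
Qed.
Lemma residue_add0 : left_id (cls 0) residue_add.
Proof.
move=> i; apply: class_rep_inj; apply: (absval_chain_lt na (residue_addP _ _)).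
by rewrite addrK -[rep _]subr0 absvalBC // class_ofP ?absval0.
Qed.
Lemma residue_addN : left_inverse (cls 0) residue_opp residue_add.
Proof.
move=> i; apply: class_rep_inj; apply: (absval_chain_lt na (residue_addP _ _)).
have oi : v (- rep i) <= 1 by rewrite absvalN // class_rep_le1.
apply: (@absval_chain_lt _ _ _ na _ 0); last by rewrite class_ofP ?absval0.
by rewrite subr0 -(absvalN av) opprD addrC class_ofP.
Qed.

HB.instance Definition _ :=
  Finite_isGroup.Build G residue_addA residue_add0 residue_addN.

(** By Cauchy's theorem a prime dividing the order of the additive residue group is the order of
    some class; multiplication by p kills every class, so this prime is p. *)
Lemma residue_card_pnat p : p \in [pchar K] -> (p.-nat n.+1)%N.
Proof.
move=> pK; have -> : n.+1 = #|[set: G]| by rewrite cardsT card_ord.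
apply/pgroupP => l l_pr /Cauchy[//|x _ ordx].
suff xp : (x ^+ p = 1)%g.
  have := order_dvdn x p; rewrite xp eqxx ordx dvdn_prime2 ?(pcharf_prime pK) //.
(* The group law is written multiplicatively, so the k-th power is the class of k times the
   representative. *)
have xk k : v (rep (x ^+ k)%g - rep x *+ k) < 1.
  elim: k => [|k IH].
    by rewrite expg0 mulr0n absvalBC // class_ofP ?absval0.
  rewrite expgS mulrS; apply: (absval_chain_lt na (residue_addP _ _)).
  by rewrite opprD addrACA subrr add0r.
apply: class_rep_inj; apply: (absval_chain_lt na (xk p)).
by rewrite -mulr_natr (pcharf0 pK) mulr0 class_ofP ?absval0.
Qed.

End ResidueClasses.

(** * Frobenius and Teichmuller representatives *)

Lemma pnat_gt0 (pi : nat_pred) n : pi.-nat n -> (0 < n)%N.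
Proof. by case/andP. Qed.

Lemma expr_sum_pchar (A : comNzRingType) (q : nat) (I : Type) (r : seq I)
  (P : pred I) (E : I -> A) : [pchar A].-nat q ->
  (\sum_(i <- r | P i) E i) ^+ q = \sum_(i <- r | P i) E i ^+ q.
Proof.
move=> qA; apply: (big_morph (fun x => x ^+ q)) => [x y|].
  exact: exprDn_pchar.
by rewrite expr0n -[q == 0]negbK -lt0n (pnat_gt0 qA).
Qed.

Lemma exprBn_pchar (A : comNzRingType) (q : nat) (x y : A) :
  [pchar A].-nat q -> (x - y) ^+ q = x ^+ q - y ^+ q.
Proof. by move=> qA; rewrite exprDn_pchar // exprNn_pchar. Qed.

Lemma expr_iter_fix (A : pzRingType) (x : A) (q d : nat) :
  x ^+ q = x -> x ^+ (q ^ d) = x.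
Proof. by move=> xq; elim: d => [|d IH]; rewrite ?expr1 // expnS exprM xq. Qed.

(** Injectivity of Frobenius lets the exponent n be replaced by its part m prime to q; Euler's
    theorem then makes q^d congruent to 1 modulo m for d the totient of m. *)
Lemma mu_infty_pchar_fix (F : fieldType) (q : nat) (z : F) :
  [pchar F].-nat q -> mu_infty_mem z ->
  exists2 d, (0 < d)%N & z ^+ (q ^ d) = z.
Proof.
move=> qF [n [n0 zn]]; have [q1|q_gt1] := leqP q 1.
  exists 1%N => //; have := pnat_gt0 qF.
  by case: q q1 {qF} => [|[]].
set m := (n`_(\pi(q))^')%N; have m0 : (0 < m)%N by rewrite part_gt0.
have zm : z ^+ m = 1.
  have [k] : exists k, [pchar F].-nat k /\ n = (m * k)%N.
    exists (n`_(\pi(q)))%N; rewrite mulnC partnC //; split=> //.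
    apply: sub_in_pnat (part_pnat _ _) => l _ lq.
    by apply: (pnatPpi qF).
  case=> kF nE; move: zn; rewrite nE exprM => zk.
  have : (z ^+ m - 1) ^+ k = 0 by rewrite exprBn_pchar // zk expr1n subrr.
  by move/eqP; rewrite expf_eq0 subr_eq0 => /andP[_ /eqP].
have cqm : coprime q m.
  have q0 : (0 < q)%N by rewrite ltnW.
  by rewrite (@pnat_coprime \pi(q)) ?part_pnat // pnat_pi.
exists (totient m); first by rewrite totient_gt0.
have qm := Euler_exp_totient cqm.
by rewrite -(expr_mod _ zm) qm (expr_mod _ zm) expr1.
Qed.

Section Teichmuller.
Variables (R : realType) (K : fieldType) (v : K -> R) (q : nat).
Hypotheses (av : is_absval v) (na : nonarch v) (vc : vcomplete v).
Hypotheses (qK : [pchar K].-nat q) (q1 : (1 < q)%N).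
Hypothesis residue_exp : forall x, v x <= 1 -> v (x ^+ q - x) < 1.

(** The representative is the limit of x^(q^n): by additivity of Frobenius, consecutive terms differ
    by (x^q - x)^(q^n), and |x^q - x| < 1. *)
Lemma teichmuller_exists x : v x <= 1 ->
  exists2 a, a ^+ q = a & v (x - a) < 1.
Proof.
move=> x1; have c1 := residue_exp x1; set c := v (_ - x) in c1.
have c0 : 0 <= c by apply: absval_ge0.
have qn n : (n <= q ^ n)%N by rewrite ltnW // ltn_expl.
have step n : v (x ^+ (q ^ n.+1) - x ^+ (q ^ n)) <= c ^+ (q ^ n).
  by rewrite expnS exprM -exprBn_pchar ?pnatX ?qK // (absvalX av) lexx.
have [|a ua] := cvg_of_steps av na (u := fun n => x ^+ (q ^ n)) vc.
  move=> e e0; have [|N cN] := @exp_lt_eps _ c e _ e0; first by rewrite c0.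
  exists N => m /cN; apply/le_lt_trans/(le_trans (step m)).
  by rewrite ler_wiXn2l // ltW.
exists a.
  (* The shifted sequence converges to a and also to a^q. For the latter, the error is kept below 1
     so that its q-th power is no larger. *)
  apply/esym/(vconv_uniq av na (u := fun n => x ^+ (q ^ n.+1))).
    by move=> e /ua[N uN]; exists N => n Nn; apply: uN; rewrite ltnW.
  move=> e e0; have [|N uN] := ua (Num.min e 1); first by rewrite lt_min e0 ltr01.
  exists N => n /uN; rewrite lt_min => /andP[une un1].
  rewrite expnSr exprM -exprBn_pchar // absvalX //; apply: le_lt_trans une.
  by rewrite -[leRHS]expr1 ler_wiXn2l ?absval_ge0 // ltW.
rewrite absvalBC //; apply: (le_lt_trans _ c1); apply: (vconv_le av na ua).
exists 0%N => n _; elim: n => [|n IH]; first by rewrite expr1 subrr absval0.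
apply: (absval_chain_le na) IH; apply: le_trans (step _) _.
by rewrite -[leRHS]expr1 ler_wiXn2l ?expn_gt0 ?(ltnW q1) // ltW.
Qed.

End Teichmuller.

(** * The unramified Frobenius is an isometry *)

Section UnramifiedFrobenius.
Variables (R : realType) (K L : fieldType) (v : K -> R) (w : L -> R).
Variables (iota : {rmorphism K -> L}) (q : nat) (pi : K).
Hypotheses (av : is_absval v) (na : nonarch v) (vc : vcomplete v).
Hypotheses (aw : is_absval w) (naw : nonarch w).
Hypothesis w_iota : forall x, w (iota x) = v x.
Hypotheses (qK : [pchar K].-nat q) (q1 : (1 < q)%N).
Hypothesis residue_exp : forall x, v x <= 1 -> v (x ^+ q - x) < 1.
Hypothesis pi_lt1 : 0 < v pi < 1.
Hypothesis v_discrete : forall x, x != 0 -> exists z : int, v x = v pi ^ z.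

(* Formal combinations [sum a_i u_i] are kept as lists of pairs, so that the
   conjugate [sum a_i u_i^q] makes sense before it is known to depend only on
   the value of the sum. *)
Definition pairing (E : L -> L) (r : seq (K * L)) : L :=
  \sum_(x <- r) iota x.1 * E x.2.

Let frob (u : L) := u ^+ q.

Let pchar_natL n : [pchar K].-nat n -> [pchar L].-nat n.
Proof. by rewrite (eq_pnat _ (fmorph_pchar iota)). Qed.

Let pi0 : pi != 0.
Proof. by rewrite -(absval_gt0 av); case/andP: pi_lt1. Qed.

(** Discreteness of the valuation enters here: a nonzero x with |x| < 1 has |x| = |pi|^k with k >=
    1. *)
Lemma uniformizer_dvd x : v x < 1 -> v (x / pi) <= 1.
Proof.
have /andP[vp0 vp1] := pi_lt1.
have [->|x0] := eqVneq x 0; first by rewrite mul0r absval0.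
rewrite absvalM // absvalV //; have [z ->] := v_discrete x0; case: z => [[|k]|k] vz.
- by rewrite expr0z ltxx in vz.
- by rewrite -exprnP exprSr mulfK ?gt_eqF // exprn_ile1 ?ltW.
- by move: vz; rewrite NegzE -exprnN invf_lt1 ?exprn_gt0 // ltNge
    (exprn_ile1 _ (ltW vp0) (ltW vp1)).
Qed.

Lemma frob_fixed_absval d u : (0 < d)%N -> u ^+ (q ^ d) = u -> u != 0 -> w u = 1.
Proof.
move=> d0 uq u0; have qd : (1 < q ^ d)%N by rewrite -(exp1n d) ltn_exp2r.
apply: (@absval_unity_root _ _ _ aw (q ^ d).-1); first by rewrite -ltnS prednK // ltnW.
by apply: (mulfI u0); rewrite mulr1 -exprS prednK // ltnW.
Qed.

Lemma frob_fixed_absval_le1 d u : (0 < d)%N -> u ^+ (q ^ d) = u -> w u <= 1.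
Proof.
move=> d0 uq; have [->|u0] := eqVneq u 0; first by rewrite absval0.
by rewrite (frob_fixed_absval d0).
Qed.

Lemma pairing_le1 (E : L -> L) r :
  (forall x, x \in r -> v x.1 <= 1 /\ w (E x.2) <= 1) -> w (pairing E r) <= 1.
Proof.
move=> rE; rewrite /pairing big_seq; apply: absval_sum_le => // x /rE[x1 x2].
by rewrite absvalM // w_iota mulr_ile1 // absval_ge0.
Qed.

(* One step peels off the Teichmuller digits of the coefficients: their
   combination is fixed by a power of Frobenius, so it is 0 or a unit. *)
Lemma pairing_step d (r : seq (K * L)) : (0 < d)%N ->
  (forall x, x \in r -> v x.1 <= 1 /\ x.2 ^+ (q ^ d) = x.2) ->
  w (pairing id r) = w (pairing frob r) \/
  exists r', [/\ forall x, x \in r' -> v x.1 <= 1 /\ x.2 ^+ (q ^ d) = x.2,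
    pairing id r = iota pi * pairing id r' &
    pairing frob r = iota pi * pairing frob r'].
Proof.
move=> d0 r1.
have qdL : [pchar L].-nat (q ^ d)%N by rewrite pnatX pchar_natL.
(* [T] selects the Teichmuller digit; its value outside the valuation ring is arbitrary. *)
have /choice[T hT] x : exists a, v x <= 1 -> a ^+ q = a /\ v (x - a) < 1.
  have [x1|_] := boolP (v x <= 1); last by exists 0.
  by have [a] := teichmuller_exists av na vc qK q1 residue_exp x1; exists a.
pose s := \sum_(x <- r) iota (T x.1) * x.2.
pose r' := [seq ((x.1 - T x.1) / pi, x.2) | x <- r].
have r'1 x : x \in r' -> v x.1 <= 1 /\ x.2 ^+ (q ^ d) = x.2.
  case/mapP=> y /r1[y1 y2] -> /=; split=> //.
  by apply: uniformizer_dvd; case: (hT y.1).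
have pairE E : pairing E r =
    \sum_(x <- r) iota (T x.1) * E x.2 + iota pi * pairing E r'.
  rewrite /pairing big_map mulr_sumr -big_split /=; apply: eq_bigr => x _.
  by rewrite mulrA -rmorphM [pi * _]mulrC divfK // rmorphB mulrBl addrC subrK.
(* Digits are fixed by the q-th power, so only the second components get conjugated. *)
have sq : s ^+ q = \sum_(x <- r) iota (T x.1) * frob x.2.
  rewrite expr_sum_pchar ?pchar_natL // !big_seq; apply: eq_bigr => x /r1[x1 _].
  by rewrite exprMn -rmorphXn /= (hT _ x1).1.
have sqd : s ^+ (q ^ d) = s.
  rewrite expr_sum_pchar // /s !big_seq; apply: eq_bigr => x /r1[x1 x2].
  by rewrite exprMn -rmorphXn /= expr_iter_fix ?x2 // (hT _ x1).1.
have [s0|s0] := eqVneq s 0.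
  right; exists r'; split=> //; rewrite pairE; first by rewrite -/s s0 add0r.
  by rewrite -sq s0 expr0n -[q == 0]negbK -lt0n ltnW // add0r.
(* Now s and s^q have absolute value 1 and dominate the remainders, which are multiples of pi. *)
have ws := frob_fixed_absval d0 sqd s0.
have small E : (forall x, x \in r' -> w (E x.2) <= 1) ->
    w (iota pi * pairing E r') < 1.
  move=> E1; rewrite absvalM // w_iota; case/andP: pi_lt1 => vp0 vp1.
  apply: le_lt_trans vp1; rewrite ler_piMr ?(ltW vp0) // pairing_le1 // => x xr'.
  by split; [case: (r'1 x xr') | exact: E1].
left; rewrite !pairE -sq -/s !absvalD_dom // ?absvalX // ?ws ?expr1n //;
  apply: small => x /r'1[_].
  by move=> x2; rewrite /frob absvalX // exprn_ile1 ?absval_ge0 //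
    (frob_fixed_absval_le1 d0).
exact: frob_fixed_absval_le1.
Qed.

(** Peeling digits repeatedly either reaches a level with a unit, where both absolute values agree,
    or bounds both by every power of |pi|, so that both vanish. *)
Lemma pairing_frob_isometry d (r : seq (K * L)) : (0 < d)%N ->
  (forall x, x \in r -> x.2 ^+ (q ^ d) = x.2) ->
  w (pairing id r) = w (pairing frob r).
Proof.
move=> d0 rq; have /andP[vp0 vp1] := pi_lt1.
have pi_pow e : 0 < e -> exists N, forall n, (N <= n)%N -> v pi ^+ n < e.
  by apply: exp_lt_eps; rewrite ltW.
(* A power of pi clears all denominators. The added 1 in the bound keeps it positive for a zero
   coefficient. *)
have [k rk] : exists k, forall x, x \in r -> v (x.1 * pi ^+ k) <= 1.
  elim: r {rq} => [|x r [k IH]]; first by exists 0%N.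
  have [|N hN] := pi_pow (v x.1 + 1)^-1.
    by rewrite invr_gt0 ltr_wpDl ?absval_ge0.
  exists (k + N)%N => y; rewrite inE => /predU1P[->|/IH yk].
    have /hN : (N <= k + N)%N by rewrite leq_addl.
    have vx := absval_ge0 av x.1.
    rewrite absvalM // absvalX // -[X in _ < X]mul1r ltr_pdivlMr ?ltr_wpDl // => h.
    apply: ltW; apply: le_lt_trans h; rewrite mulrC ler_wpM2l ?exprn_ge0 ?(ltW vp0) //.
    by rewrite lerDl.
  rewrite exprD mulrA absvalM // mulr_ile1 ?absval_ge0 //.
  by rewrite absvalX // exprn_ile1 ?ltW.
have approx m (s : seq (K * L)) :
    (forall x, x \in s -> v x.1 <= 1 /\ x.2 ^+ (q ^ d) = x.2) ->
  w (pairing id s) = w (pairing frob s) \/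
  (w (pairing id s) <= v pi ^+ m /\ w (pairing frob s) <= v pi ^+ m).
  elim: m s => [|m IH] s s1.
    right; split; apply: pairing_le1 => x /s1[x1 x2]; split=> //.
      exact: (frob_fixed_absval_le1 d0).
    rewrite /frob absvalX // exprn_ile1 ?absval_ge0 //.
    exact: (frob_fixed_absval_le1 d0).
  have [|[s' [/IH IHs' -> ->]]] := pairing_step d0 s1; first by left.
  rewrite !absvalM // w_iota; case: IHs' => [->|[h1 h2]]; first by left.
  by right; rewrite exprS !ler_pM2l.
pose s := [seq (x.1 * pi ^+ k, x.2) | x <- r].
have sE E : pairing E s = iota (pi ^+ k) * pairing E r.
  rewrite /pairing big_map mulr_sumr; apply: eq_bigr => x _ /=.
  by rewrite rmorphM mulrAC mulrC.
suff : w (pairing id s) = w (pairing frob s).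
  rewrite !sE !absvalM // w_iota; apply: mulfI.
  by rewrite absval_eq0 // expf_neq0.
apply/eqP/negPn/negP => neq.
have small m : w (pairing id s) <= v pi ^+ m /\ w (pairing frob s) <= v pi ^+ m.
  have [x /mapP[y yr ->]|/eqP|//] := approx m s; last by rewrite (negPf neq).
  by split=> /=; [exact: rk | exact: rq].
have zero y : 0 <= y -> (forall m, y <= v pi ^+ m) -> y = 0.
  move=> y0 ym; apply/le_anti; rewrite y0 andbT leNgt.
  apply/negP => /pi_pow[N /(_ N (leqnn N))].
  by rewrite ltNge ym.
have w1 : w (pairing id s) = 0.
  by apply: zero => [|m]; [exact: absval_ge0 | case: (small m)].
have w2 : w (pairing frob s) = 0.
  by apply: zero => [|m]; [exact: absval_ge0 | case: (small m)].
by case/eqP: neq; rewrite w1 w2.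
Qed.

End UnramifiedFrobenius.

(** * Zeros of Laurent series on the unit circle *)

Lemma lpsum0 (F : fieldType) (f : int -> F) x : lpsum f x 0 = f 0.
Proof. by rewrite /lpsum big_ord_recl big_ord0 subrr expr0z mulr1 addr0. Qed.

Lemma lpsumS (F : fieldType) (f : int -> F) x N :
  lpsum f x N.+1 = f (- N.+1%:Z) * x ^ (- N.+1%:Z) + lpsum f x N +
    f N.+1%:Z * x ^ N.+1%:Z.
Proof.
rewrite /lpsum doubleS big_ord_recr big_ord_recl /= sub0r.
congr (_ + _ + _); last first.
  by have -> : N.*2.+2%:Z - N.+1%:Z = N.+1%:Z by lia.
apply: eq_bigr => i _; rewrite /bump /=.
by have -> : (1 + i)%N%:Z - N.+1%:Z = i%:Z - N%:Z by lia.
Qed.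

Section LaurentZeros.
Variables (R : realType) (F : fieldType) (w : F -> R) (z : F).
Hypotheses (aw : is_absval w) (naw : nonarch w) (wc : vcomplete w).
Hypothesis wz : w z = 1.

Let z0 : z != 0. Proof. by rewrite -(absval_gt0 aw) wz. Qed.

Let wM x (n : int) : w (x * z ^ n) = w x.
Proof. by rewrite absvalM // absval_exprz1 // mulr1. Qed.

(** For |z| = 1 the terms are as small as the coefficients, so the steps of the symmetric partial
    sums tend to 0. *)
Lemma A11_laurent_value g : in_A11 w g -> exists l, laurent_value w g z l.
Proof.
move=> gA; apply: (cvg_of_steps aw naw wc) => e e0; have [N gN] := gA e e0.
exists N => n Nn; rewrite lpsumS addrAC addrK.
by apply: (absvalD_lt naw); rewrite wM gN //; lia.
Qed.

(* The quotient is [h_n = \sum_(k > n) g_k z^(k-n-1)]; the vanishing of g at z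
   makes it also [- \sum_(k <= n) g_k z^(k-n-1)], whence its decay at -oo. *)
Lemma laurent_zero_div g : in_A11 w g -> laurent_value w g z 0 ->
  exists2 h, in_A11 w h & g = lmulXa z h.
Proof.
move=> gA g0; pose u (n : int) (M : nat) : F := \sum_(i < M) g (n + 1 + i%:Z) * z ^+ i.
have wu x (i : nat) : w (x * z ^+ i) = w x by rewrite exprnP wM.
have /choice[h uh] n : exists l, vconv w (u n) l.
  apply: (cvg_of_steps aw naw wc) => e e0; have [N gN] := gA e e0.
  exists (N + `|(n + 1)%R|)%N => M NM; rewrite /u big_ord_recr /= addrAC subrr add0r.
  by rewrite wu gN //; lia.
(* This is g = (X - z) h coefficientwise; it follows by splitting off the first term of a partial
   sum. *)
have hS (n : int) : h (n - 1) = g n + z * h n.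
  apply: (vconv_uniq aw naw (u := fun M => u (n - 1) M.+1)) => e e0.
    by have [N uN] := uh (n - 1) e e0; exists N => M NM; apply: uN; rewrite ltnW.
  have [N uN] := uh n e e0; exists N => M /uN.
  suff -> : u (n - 1) M.+1 - (g n + z * h n) = z * (u n M - h n).
    by rewrite absvalM // wz mul1r.
  rewrite /u big_ord_recl expr0 mulr1 subrK addr0 mulrBr opprD addrACA subrr add0r.
  congr (_ - _); rewrite mulr_sumr; apply: eq_bigr => i _.
  rewrite mulrCA -exprS; congr (g _ * _).
  rewrite lift0; lia.
have h_le (n : int) e : (forall k, (n < k)%R -> w (g k) <= e) -> w (h n) <= e.
  move=> ge; rewrite -[h n]subr0; apply: (vconv_le aw naw (uh n)).
  exists 0%N => M _; rewrite subr0; apply: absval_sum_le => //.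
    by apply: le_trans (ge (n + 1) _); [apply: absval_ge0 | lia].
  by move=> i _; rewrite wu ge //; lia.
(* The recurrence, summed over the indices from -M to M, ties h at -M - 1 to h at M and to a partial
   sum tending to g(z) = 0. *)
have h_low M : z ^ (- M%:Z) * h (- M%:Z - 1) = z ^ (M%:Z + 1) * h M%:Z + lpsum g z M.
  elim: M => [|M IH].
    by rewrite lpsum0 oppr0 hS expr0z mul1r !add0r expr1z addrC.
  have zS (n : int) : z ^ n * h (n - 1) = z ^ (n + 1) * h n + g n * z ^ n.
    by rewrite hS expfzDr // expr1z; ring.
  rewrite lpsumS zS.
  have -> : - M.+1%:Z + 1 = - M%:Z by lia.
  have -> : h (- M.+1%:Z) = h (- M%:Z - 1) by congr h; lia.
  have := zS M.+1%:Z.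
  have -> : M.+1%:Z - 1 = M%:Z by lia.
  move=> zM; rewrite IH.
  have -> : M%:Z + 1 = M.+1%:Z :> int by lia.
  by rewrite zM; ring.
exists h; last first.
  by apply/funext => n; rewrite /lmulXa hS addrK.
move=> e e0; have e2 : 0 < e / 2 by rewrite divr_gt0.
have e2e : e / 2 < e by lra.
have [N1 gN] := gA _ e2; have [N2 sN] := g0 _ e0.
have h_pos n : (N1%:Z <= n)%R -> w (h n) < e.
  by move=> Nn; apply: le_lt_trans e2e; apply: h_le => k nk; rewrite ltW // gN //; lia.
(* The extra 1 is there because a negative n is written -M - 1. *)
exists (N1 + N2 + 1)%N => n Nn; case: (lerP 0 n) => n0; first by apply: h_pos; lia.
have [M [nM NM]] : exists M : nat, n = - M%:Z - 1 /\ (N1 + N2 <= M)%N.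
  by exists (`|n|.-1)%N; lia.
rewrite nM -(wM _ (- M%:Z)) mulrC h_low; apply: (absvalD_lt naw).
  by rewrite mulrC wM h_pos //; lia.
by rewrite -[lpsum _ _ _]subr0 sN //; lia.
Qed.

(** [c] is the Gauss norm, and [a], [b] are the ends of the slope-zero segment of the Newton
    polygon, possibly reduced to a point. *)
Definition gauss_range (h : int -> F) (c : R) (a b : int) : Prop :=
  [/\ 0 < c, forall n, w (h n) <= c, w (h a) = c /\ w (h b) = c,
    forall n, n < a -> w (h n) < c & forall n, b < n -> w (h n) < c].

(** Coefficients far from 0 are smaller than the nonzero one at [n0], so the maximum is sought in a
    finite window. *)
Lemma gauss_range_exists h n0 : in_A11 w h -> h n0 != 0 ->
  exists c a b, gauss_range h c a b.
Proof.
move=> hA; rewrite -(absval_gt0 aw) => h0; have [N hN] := hA _ h0.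
pose k (i : nat) : int := i%:Z - N%:Z.
have kP n : (`|n| < N)%N -> exists i : 'I_N.*2.+1, n = k i.
  move=> nN; have iN : (`|(n + N%:Z)%R| < N.*2.+1)%N by lia.
  by exists (Ordinal iN); rewrite /k /=; lia.
have n0N : (`|n0| < N)%N.
  by rewrite ltnNge; apply/negP => /hN; rewrite ltxx.
have [i0 i0E] := kP _ n0N.
case: (@Order.TotalTheory.arg_maxP _ _ _ i0 xpredT
  (fun i : 'I_N.*2.+1 => w (h (k i)))) => // im _ im_max.
set c := w (h (k im)) in im_max.
have h0c : w (h n0) <= c by rewrite i0E; apply: im_max.
have hc n : w (h n) <= c.
  have [nN|/hN/ltW/le_trans] := ltnP `|n| N; last exact.
  by have [i ->] := kP _ nN; apply: im_max.
pose P i := (i < N.*2.+1)%N && (w (h (k i)) == c).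
have exP : exists i, P i by exists im; rewrite /P ltn_ord eqxx.
have out n : w (h n) != c -> w (h n) < c by move=> nc; rewrite lt_def eq_sym nc hc.
have far n : (N <= `|n|)%N -> w (h n) < c by move=> /hN/lt_le_trans; apply.
have ubP i : P i -> (i <= N.*2)%N by case/andP.
case: (ex_minnP exP) => a /andP[aN /eqP ha] amin.
case: (ex_maxnP exP ubP) => b /andP[bN /eqP hb] bmax.
exists c, (k a), (k b); split=> // [|n na|n bn].
- exact: lt_le_trans h0c.
- have [nN|] := ltnP `|n| N; last exact: far.
  have [i nE] := kP _ nN; apply: out; rewrite nE; apply/negP => hi.
  have := amin i; rewrite /P ltn_ord hi => /(_ isT).
  by move: na; rewrite nE /k; lia.
- have [nN|] := ltnP `|n| N; last exact: far.
  have [i nE] := kP _ nN; apply: out; rewrite nE; apply/negP => hi.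
  have := bmax i; rewrite /P ltn_ord hi => /(_ isT).
  by move: bn; rewrite nE /k; lia.
Qed.

(** At a and at b + 1 exactly one of the two terms forming the new coefficient has absolute value c,
    and it dominates the other. *)
Lemma gauss_range_lmulXa h c a b :
  gauss_range h c a b -> gauss_range (lmulXa z h) c a (b + 1).
Proof.
case=> c0 hc [ha hb] la lb; have wz_ x : w (z * x) = w x by rewrite absvalM // wz mul1r.
rewrite /lmulXa; split=> // [n||n na|n bn].
- by apply: (absvalB_le aw naw); rewrite ?wz_.
- split.
    by rewrite addrC absvalD_dom // absvalN // wz_ ha // la //; lia.
  by rewrite addrK absvalD_dom // absvalN // wz_ hb lb //; lia.
- by apply: (absvalB_lt aw naw); rewrite ?wz_ la //; lia.
- by apply: (absvalB_lt aw naw); rewrite ?wz_ lb //; lia.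
Qed.

Lemma gauss_range_le h c a b : gauss_range h c a b -> a <= b.
Proof.
by case=> c0 _ [ha hb] la _; rewrite leNgt; apply/negP => /la; rewrite hb ltxx.
Qed.

Lemma gauss_range_uniq h c a b c' a' b' :
  gauss_range h c a b -> gauss_range h c' a' b' -> a = a' /\ b = b'.
Proof.
case=> _ hc [ha hb] la lb [_ hc' [ha' hb'] la' lb'].
have cc' : c = c' by apply/le_anti; rewrite -{1}ha hc' -ha' hc.
rewrite -cc' in ha' hb' la' lb'.
split; [case: (ltgtP a a') | case: (ltgtP b b')] => // [/la'|/la|/lb|/lb'].
- by rewrite ha ltxx.
- by rewrite ha' ltxx.
- by rewrite hb' ltxx.
- by rewrite hb ltxx.
Qed.

(* Division by [X - z] shortens the range of indices where the Gauss norm is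
   attained. *)
Lemma zero_mult_exists g n0 : in_A11 w g -> g n0 != 0 -> exists m, zero_mult w g z m.
Proof.
move=> gA /(gauss_range_exists gA)[c [a [b]]].
have [k] := ubnP `|b - a|%N; elim: k => // k IH in g c a b gA *.
rewrite ltnS => ab gr; have [l gl] := A11_laurent_value gA.
have [l0|l0] := eqVneq l 0; last by exists 0%N, g; split=> //; exists l.
rewrite l0 in gl; have [h hA gE] := laurent_zero_div gA gl.
have [n hn] : exists n, h n != 0.
  apply: contrapT => /forallNP h0; case: gr => c0 _ [ga _] _ _.
  have hE n : h n = 0 by apply/eqP/negPn/negP; apply: h0.
  by move: c0; rewrite -ga gE /lmulXa !hE mulr0 subrr absval0 // ltxx.
have [c' [a' [b' hr]]] := gauss_range_exists hA hn.
have := gauss_range_lmulXa hr; rewrite -gE => gr'.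
(* Uniqueness gives a = a' and b = b' + 1. Since a' <= b', the absolute value of the difference
   really decreases. *)
have [aE bE] := gauss_range_uniq gr gr'; have ab' := gauss_range_le hr.
have [|m [h' [h'A hE hl]]] := IH h c' a' b' hA _ hr; first by lia.
by exists m.+1, h'; split=> //; rewrite gE hE.
Qed.

End LaurentZeros.

(** * Powers of Laurent series in characteristic p *)

Section IntIndexedCoefficients.
Variable F : fieldType.
Implicit Types P Q : {poly F}.

(** Extension by zero to negative indices allows comparison with shifted Laurent coefficients. *)
Definition zcoef P (n : int) : F := if n is Posz k then P`_k else 0.

Lemma zcoef_neg P n : n < 0 -> zcoef P n = 0. Proof. by case: n. Qed.

Lemma zcoefM P Q n :
  zcoef (P * Q) n = \sum_(j < size P) P`_j * zcoef Q (n - j%:Z).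
Proof.
case: n => n; last first.
  by rewrite big1 // => j _; rewrite zcoef_neg ?mulr0 //; lia.
rewrite /= -{1}[P]coefK poly_def mulr_suml coef_sum; apply: eq_bigr => j _.
rewrite -scalerAl coefZ coefXnM; case: ltnP => nj.
  by rewrite zcoef_neg ?mulr0 // subr_lt0.
by rewrite subzn.
Qed.

(** The symmetric window of [is_lprod], shifted by s, contains all indices from 0 to [size P] - 1
    because of the bound on M; the other terms vanish. *)
Lemma zcoefM_window P Q (s M : nat) n : (s + size P <= M)%N ->
  zcoef (P * Q) n = \sum_(i < M.*2.+1)
    zcoef P (i%:Z - M%:Z + s%:Z) * zcoef Q (n - (i%:Z - M%:Z + s%:Z)).
Proof.
move=> sM; rewrite zcoefM.
pose G (i : int) := zcoef P i * zcoef Q (n - i).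
rewrite -(big_mkord xpredT (fun i => G (i%:Z - M%:Z + s%:Z))).
symmetry; rewrite (@big_cat_nat _ _ _ (M - s)) /=; [|lia|lia].
rewrite big_nat big1 ?add0r; last first.
  by move=> i iM; rewrite /G zcoef_neg ?mul0r //; lia.
rewrite -{1}[(M - s)%N]add0n big_addn.
rewrite (@big_cat_nat _ _ _ (size P)) /=; [|by []|by move: (size P) sM => m; lia].
rewrite [X in _ + X]big_nat [X in _ + X]big1 ?addr0; last first.
  move=> i iM; have -> : (i + (M - s))%N%:Z - M%:Z + s%:Z = i%:Z by lia.
  by rewrite /G /= nth_default ?mul0r //; lia.
rewrite big_mkord; apply: eq_bigr => i _.
by have -> : (i + (M - s))%N%:Z - M%:Z + s%:Z = i%:Z by lia.
Qed.

(** By additivity of Frobenius, P^q is the polynomial with coefficients P_i^q composed with X^q. *)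
Lemma coef_expr_pchar q P k : [pchar F].-nat q ->
  (P ^+ q)`_k = if (q %| k)%N then P`_(k %/ q) ^+ q else 0.
Proof.
move=> qF; have q0 := pnat_gt0 qF.
have qP : [pchar {poly F}].-nat q by rewrite (eq_pnat _ (pchar_poly F)).
have -> : P ^+ q = (\poly_(i < size P) P`_i ^+ q) \Po 'X^q.
  rewrite -{1}[P]coefK !poly_def expr_sum_pchar // linear_sum.
  apply: eq_bigr => i _; rewrite linearZ /= exprZn comp_Xn_poly -!exprM.
  by rewrite mulnC.
rewrite coef_comp_poly_Xn // coef_poly; case: ifP => // _; case: ltnP => // Pk.
by rewrite nth_default // expr0n -[q == 0]negbK -lt0n q0.
Qed.

End IntIndexedCoefficients.

Section LaurentPower.
Variables (R : realType) (F : fieldType) (w : F -> R) (a : int -> F).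
Hypotheses (aw : is_absval w) (naw : nonarch w) (aA : in_A11 w a).

Definition laurent_trunc N : {poly F} := \poly_(i < N.*2.+1) a (i%:Z - N%:Z).

Lemma zcoef_laurent_trunc N n :
  zcoef (laurent_trunc N) (n + N%:Z) = if (`|n| <= N)%N then a n else 0.
Proof.
case: leqP => nN.
  have [k nE] : exists k : nat, n + N%:Z = k%:Z by exists (`|(n + N%:Z)%R|)%N; lia.
  by rewrite nE /= coef_poly ifT; [congr a; lia | lia].
case E : (n + N%:Z) => [k|//]; rewrite /= coef_poly ifF //; lia.
Qed.

Lemma A11_bounded : exists2 B, 0 < B & forall n, w (a n) <= B.
Proof.
have [N aN] := aA (ltr01 : 0 < 1 :> R).
pose S := \sum_(i < N.*2.+1) w (a (i%:Z - N%:Z)).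
have S0 : 0 <= S by apply: sumr_ge0 => i _; apply: absval_ge0.
exists (1 + S) => [|n]; first by rewrite ltr_wpDr.
have [nN|/aN/ltW an] := ltnP `|n| N; last by rewrite ler_wpDr.
have iN : (`|(n + N%:Z)%R| < N.*2.+1)%N by lia.
have -> : n = (Ordinal iN)%:Z - N%:Z by rewrite /=; lia.
rewrite ler_wpDl // /S (bigD1 (Ordinal iN)) //= lerDl.
by apply: sumr_ge0 => i _; apply: absval_ge0.
Qed.

Lemma laurent_trunc_approx e : 0 < e -> exists N0, forall N, (N0 <= N)%N ->
  forall n, w (a n - zcoef (laurent_trunc N) (n + N%:Z)) <= e.
Proof.
move=> e0; have [N0 aN] := aA e0; exists N0 => N NN n.
rewrite zcoef_laurent_trunc; case: leqP => nN.
  by rewrite subrr absval0 // ltW.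
by rewrite subr0 ltW // aN //; lia.
Qed.

(* Shifting by N turns the truncation of a to [-N, N] into a polynomial, whose
   k-th power is shifted by k N. *)
Lemma lpow_approx k c : is_lpow w a k c ->
  (exists2 B, 0 < B & forall n, w (c n) <= B) /\
  forall e, 0 < e -> exists N0, forall N, (N0 <= N)%N ->
    forall n, w (c n - zcoef (laurent_trunc N ^+ k) (n + (k * N)%N%:Z)) <= e.
Proof.
elim: k c => [c ->|k IH c [d [/IH[[B B0 dB] dapp] cE]]].
  split.
    by exists 1 => // n; case: (n == 0); rewrite ?absval1 ?absval0.
  move=> e e0; exists 0%N => N _ n; rewrite mul0n addr0 expr0.
  suff -> : zcoef (1 : {poly F}) n = (n == 0)%:R by rewrite subrr absval0 // ltW.
  by case: n => n //=; rewrite coef1.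
have [B' B'0 aB] := A11_bounded.
split.
  exists (B * B') => [|n]; first by rewrite mulr_gt0.
  rewrite -[c n]subr0; apply: (vconv_le aw naw (cE n)); exists 0%N => M _.
  rewrite subr0; apply: absval_sum_le => // [|i _]; first by rewrite mulr_ge0 ?ltW.
  by rewrite absvalM // ler_pM ?absval_ge0.
(* The thresholds e/B' and e/B balance the two error terms, whose other factors are bounded by B'
   and B respectively. *)
move=> e e0; have [|N1 h1] := dapp (e / B'); first by rewrite divr_gt0.
have [|N2 h2] := @laurent_trunc_approx (e / B); first by rewrite divr_gt0.
exists (N1 + N2)%N => N NN n; apply: (vconv_le aw naw (cE n)).
set P := laurent_trunc N; exists (k * N + size (P ^+ k))%N => M NM.
rewrite exprSr (@zcoefM_window _ _ _ (k * N) M) // -sumrB.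
apply: absval_sum_le => // [|i _]; first exact: ltW.
set j := i%:Z - M%:Z.
have -> : n + (k.+1 * N)%N%:Z - (j + (k * N)%N%:Z) = n - j + N%:Z by lia.
set D := zcoef (P ^+ k) _; set A := zcoef P _.
have -> : d j * a (n - j) - D * A = d j * (a (n - j) - A) + (d j - D) * A by ring.
have wA : w A <= B'.
  rewrite /A zcoef_laurent_trunc; case: ifP => _ //; by rewrite absval0 // ltW.
apply: (absvalD_le naw); rewrite absvalM //.
  rewrite -[leRHS](@divfK _ B) ?gt_eqF // mulrC.
  by rewrite ler_pM ?absval_ge0 ?h2 //; lia.
rewrite -[leRHS](@divfK _ B') ?gt_eqF //.
by rewrite ler_pM ?absval_ge0 ?h1 //; lia.
Qed.

(** Once N >= |n|, the q-th power of the truncation has exactly this coefficient, the shift by q N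
    preserving divisibility by q; the approximation error is arbitrary. *)
Lemma lpow_pchar q c n : [pchar F].-nat q -> is_lpow w a q c ->
  c n = if (q%:Z %| n)%Z then a (n %/ q%:Z)%Z ^+ q else 0.
Proof.
move=> qF /lpow_approx[_ capp]; have q0 := pnat_gt0 qF.
apply/eqP; rewrite -subr_eq0 -(absval_eq0 aw) eq_le absval_ge0 // andbT.
apply/ler_addgt0Pl => e e0; rewrite addr0; have [N0 h] := capp e e0.
have := h (N0 + `|n|)%N (leq_addr _ _) n; set N := (_ + `|n|)%N.
suff -> : zcoef (laurent_trunc N ^+ q) (n + (q * N)%N%:Z) =
  if (q%:Z %| n)%Z then a (n %/ q%:Z)%Z ^+ q else 0 by [].
have [k kE] : exists k : nat, n + (q * N)%N%:Z = k%:Z.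
  by exists (`|(n + (q * N)%N%:Z)%R|)%N; nia.
rewrite kE /= coef_expr_pchar //; case: (boolP (q%:Z %| n)%Z) => [/dvdzP[m nE]|ndv].
  have [j jE] : exists j : nat, m + N%:Z = j%:Z by exists (`|(m + N%:Z)%R|)%N; nia.
  have -> : k = (j * q)%N by nia.
  rewrite dvdn_mull // mulnK // nE mulzK; last by lia.
  have := zcoef_laurent_trunc N m; rewrite jE /= => ->; rewrite ifT //; nia.
rewrite ifN //; apply: contra ndv => /dvdnP[j jE]; apply/dvdzP.
by exists (j%:Z - N%:Z); nia.
Qed.

End LaurentPower.

(** * Zeros coming from roots of unity *)

(** For h(X^q) only multiples q j contribute, and q j lies in [-M, M] exactly when |j| is at most
    the integer quotient of M by q. *)
Lemma lpsum_stretch (F : fieldType) (h : int -> F) (q : nat) (z : F) M :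
  (0 < q)%N ->
  lpsum (fun n => if (q%:Z %| n)%Z then h (n %/ q%:Z)%Z else 0) z M =
  lpsum h (z ^+ q) (M %/ q)%N.
Proof.
move=> q0; elim: M => [|M IH]; first by rewrite div0n !lpsum0 dvdz0 div0z.
rewrite lpsumS IH divnS // rpredN.
have -> : (q%:Z %| M.+1%:Z)%Z = (q %| M.+1)%N by [].
have [qM|_] := boolP (q %| M.+1)%N; last by rewrite !mul0r add0r addr0.
have [j jE] : exists j, M.+1 = (j * q)%N by apply/dvdnP.
have -> : (true + M %/ q)%N = j.
  by have := divnS M q0; rewrite qM jE mulnK // => ->.
have q0z : q%:Z != 0 by lia.
have [k kE] : exists k, j = k.+1 by exists j.-1; nia.
have zq (m : int) : z ^ (m * q%:Z) = (z ^+ q) ^ m.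
  by rewrite mulrC -exprz_exp.
have -> : (M %/ q)%N = k.
  by have := divnS M q0; rewrite qM jE mulnK // kE => -[].
rewrite kE lpsumS jE PoszM kE -mulNr !mulzK // !zq //.
Qed.

(** This is G(X^q) = f(X)^q - f(X^q) at z, one truncation at a time. *)
Lemma lpsum_frob (F : fieldType) (a : int -> F) (q : nat) (z : F) N :
  [pchar F].-nat q ->
  lpsum (fun n => a n ^+ q - a n) (z ^+ q) N =
  lpsum a z N ^+ q - lpsum a (z ^+ q) N.
Proof.
move=> qF; rewrite /lpsum expr_sum_pchar // -sumrB; apply: eq_bigr => i _.
rewrite mulrBl exprMn; congr (_ * _ - _).
by rewrite !exprnP exprzAC.
Qed.

Lemma frob_fixed_alg_over_Fp (K : fieldType) (p q : nat) (x : K) :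
  prime p -> p \in [pchar K] -> (1 < q)%N -> x ^+ q = x -> alg_over_Fp p x.
Proof.
move=> pp pK q1 xq; pose lift_Fp (a : 'F_p) : K := (nat_of_ord a)%:R.
(* The coefficients of X^q - X are 0, 1 or -1, so these three values replace a proof that [lift_Fp]
   is a morphism. *)
have lift0 : lift_Fp 0 = 0 by [].
have lift1 : lift_Fp 1 = 1 by [].
have liftN1 : lift_Fp (-1) = -1.
  apply/eqP; rewrite -addr_eq0 /lift_Fp natr1 -(dvdn_pcharf pK).
  by rewrite (dvdn_pcharf (pchar_Fp pp)) -natr1 natr_Zp addNr.
exists ('X^q - 'X); split.
  apply/eqP => /(congr1 (fun P : {poly 'F_p} => P`_q)).
  rewrite coefB coefXn coefX eqxx coef0 gtn_eqF // subr0.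
  by move/eqP; rewrite oner_eq0.
have -> : map_poly lift_Fp ('X^q - 'X) = 'X^q - 'X.
  apply/polyP => i; rewrite coef_map_id0 // !coefB !coefXn !coefX.
  by case: (i == q); case: (i == 1%N); rewrite ?subrr ?subr0 ?sub0r.
by rewrite rootE !hornerE xq subrr.
Qed.

(** Nonzero fixed points of the q-th power have absolute value 1, whereas the coefficients tend to
    0; hence the support is finite. *)
Lemma frob_fixed_special (R : realType) (K : fieldType) (v : K -> R) (p q : nat)
  (f : int -> K) :
  is_absval v -> prime p -> p \in [pchar K] -> (1 < q)%N -> in_A11 v f ->
  (forall n, f n ^+ q = f n) -> special_laurent p f.
Proof.
move=> av pp pK q1 fA fq; split; last first.
  by move=> n; apply: (frob_fixed_alg_over_Fp pp pK q1).
have [N fN] := fA 1 ltr01; exists N => n /ltnW/fN fn; apply/eqP/negPn/negP => f0.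
have : v (f n) = 1.
  apply: (absval_unity_root av (n := q.-1)); first by rewrite -ltnS prednK // ltnW.
  by apply: (mulfI f0); rewrite mulr1 -exprS prednK // ltnW.
by move=> fn1; rewrite fn1 ltxx in fn.
Qed.

Lemma lpsum_frob_isometry (R : realType) (K L : fieldType) (v : K -> R) (w : L -> R)
  (iota : {rmorphism K -> L}) (q d : nat) (pi : K) (f : int -> K) (z l : L) N :
  is_absval v -> nonarch v -> vcomplete v -> is_absval w -> nonarch w ->
  (forall x, w (iota x) = v x) -> [pchar K].-nat q -> (1 < q)%N ->
  (forall x, v x <= 1 -> v (x ^+ q - x) < 1) -> 0 < v pi < 1 ->
  (forall x, x != 0 -> exists k : int, v x = v pi ^ k) ->
  (0 < d)%N -> z ^+ (q ^ d) = z -> l ^+ (q ^ d) = l ->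
  w (lpsum (iota \o f) z N - l) = w (lpsum (iota \o f) (z ^+ q) N - l ^+ q).
Proof.
move=> av na vc aw naw w_iota qK q1 rexp pi1 disc d0 zd ld.
(* The constant l enters with coefficient -1, and f_n is paired with z^n, so conjugation replaces z
   by z^q and l by l^q. *)
pose r := (-1, l) :: [seq (f (i%:Z - N%:Z), z ^ (i%:Z - N%:Z)) |
  i : 'I_N.*2.+1 <- index_enum 'I_N.*2.+1].
have rE E : pairing iota E r =
    \sum_(i < N.*2.+1) iota (f (i%:Z - N%:Z)) * E (z ^ (i%:Z - N%:Z)) - E l.
  by rewrite /pairing big_cons big_map rmorphN1 mulN1r addrC.
have := @pairing_frob_isometry R K L v w iota q pi av na vc aw naw
  w_iota qK q1 rexp pi1 disc d r d0.
rewrite !rE => ->; last first.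
  move=> x; rewrite inE => /predU1P[-> //|/mapP[i _ ->]] /=.
  by rewrite exprnP exprzAC -exprnP zd.
by congr (w (_ - _)); apply: eq_bigr => i _; rewrite !exprnP exprzAC.
Qed.

Theorem mainTheorem9 (R : realType) (p q : nat) (K : fieldType) (v : K -> R)
  (Om : closedFieldType) (w : Om -> R) (iota : {rmorphism K -> Om})
  (f : int -> K) :
  local_field_charp v p q ->
  completed_alg_closure v w iota ->
  in_A11 v f ->
  ~ special_laurent p f ->
  forall fq : int -> Om, is_lpow w (fun n => iota (f n)) q fq ->
  let g : int -> Om := fun n =>
    fq n - (if (q%:Z %| n)%Z then iota (f (n %/ q%:Z)%Z) else 0) in
  forall S : seq Om, uniq S ->
    (forall z, z \in S -> mu_infty_mem z /\
       exists l, laurent_value w (fun n => iota (f n)) z l /\ mu_infty_mem l) ->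
    exists Z : seq (Om * nat),
      [/\ uniq (map fst Z),
          forall am, am \in Z -> w am.1 = 1 /\ zero_mult w g am.1 am.2 &
          (size S <= \sum_(am <- Z) am.2)%N].
Proof.
case=> [[av na] vc [pp pK] [pi [pi1 disc]] [r [size_r r1 rsep rcov]]].
case=> aw naw wc w_iota _ fA nspecial fq fqE g S uS muS.
(* The class of 0 excludes q = 0; the lemmas on residue classes require a successor. *)
case: q => [|n] in size_r fqE g *.
  by have := rcov 0; rewrite absval0 // (size0nil size_r) => /(_ ler01).
set q := n.+1 in size_r fqE g *.
have q1 : (1 < q)%N by apply: (residue_card_gt1 av na size_r).
have rexp := residue_expE av na size_r r1 rsep rcov; rewrite -/q in rexp.
have qK : [pchar K].-nat q.
  rewrite (eq_pnat _ (pcharf_eq pK)).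
  exact: (residue_card_pnat av na size_r r1 rsep rcov pK).
have qL : [pchar Om].-nat q by rewrite (eq_pnat _ (fmorph_pchar iota)).
have q0 : (0 < q)%N by [].
pose a := iota \o f; pose G n := a n ^+ q - a n.
have aA : in_A11 w a.
  by move=> e /fA[N fN]; exists N => m /fN; rewrite /a /= w_iota.
have gE : g = fun n => if (q%:Z %| n)%Z then G (n %/ q%:Z)%Z else 0.
  apply/funext => m; rewrite /g (lpow_pchar aw naw aA _ qL fqE).
  by case: ifP => //; rewrite subr0.
have gA : in_A11 w g.
  move=> e e0; have [|N aN] := aA (Num.min e 1); first by rewrite lt_min e0 ltr01.
  exists (N * q)%N => m mN; rewrite gE.
  case: ifP => [/dvdzP[k mE]|_]; last by rewrite absval0.
  rewrite mE mulzK //; have /aN : (N <= `|k|)%N by nia.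
  rewrite lt_min => /andP[ak ak1]; apply: (absvalB_lt aw naw) => //.
  rewrite absvalX //; apply: le_lt_trans ak; rewrite -[leRHS]expr1.
  by rewrite ler_wiXn2l ?absval_ge0 // ltW.
have [m0 Gm0] : exists m, G m != 0.
  apply: contrapT => /forallNP G0; apply: nspecial.
  apply: (frob_fixed_special av pp pK q1 fA) => m.
  apply: (fmorph_inj iota); rewrite rmorphXn; apply/eqP; rewrite -subr_eq0.
  by apply/negPn/negP; apply: G0.
have gm0 : g (m0 * q%:Z) != 0 by rewrite gE dvdz_mull // mulzK.
have zeroS z : z \in S -> w z = 1 /\ laurent_value w g z 0.
  case/muS => muz [l [zl mul]].
  have [k [k0 zk]] := muz; have wz := absval_unity_root aw k0 zk; split=> //.
  have [d1 d1_0 zd] := mu_infty_pchar_fix qL muz.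
  have [d2 d2_0 ld] := mu_infty_pchar_fix qL mul.
  (* The product d1 d2 is a common Frobenius period of z and l. *)
  have iso N : w (lpsum a z N - l) = w (lpsum a (z ^+ q) N - l ^+ q).
    apply: (@lpsum_frob_isometry _ _ _ v w iota q (d1 * d2)%N pi) => //.
    - by rewrite muln_gt0 d1_0.
    - by rewrite expnM expr_iter_fix.
    - by rewrite mulnC expnM expr_iter_fix.
  move=> e e0; have [|N aN] := zl (Num.min e 1); first by rewrite lt_min e0 ltr01.
  exists (N * q)%N => M MN; rewrite subr0 gE lpsum_stretch // lpsum_frob //.
  have /aN : (N <= M %/ q)%N by rewrite leq_divRL.
  rewrite -/a -/(a \o _) lt_min; set s := lpsum _ _ _ => /andP[se s1].
  (* The partial sum of g splits as (s - l)^q plus l^q minus the partial sum of f at z^q. The first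
     is small since |s - l| < 1, and the second has absolute value |s - l| by the isometry. *)
  rewrite -[s ^+ q](subrK (l ^+ q)) -addrA; apply: (absvalD_lt naw).
    rewrite -exprBn_pchar // absvalX //; apply: le_lt_trans se.
    by rewrite -[leRHS]expr1 ler_wiXn2l ?absval_ge0 // ltW.
  by rewrite absvalBC // -iso.
have /choice[m mP] z : exists m, z \in S -> (0 < m)%N /\ zero_mult w g z m.
  have [/zeroS[wz gz]|_] := boolP (z \in S); last by exists 0%N.
  have [[|m] mz] := zero_mult_exists aw naw wc wz gA gm0; last by exists m.+1.
  (* Multiplicity 0 would give g a nonzero value at z. *)
  case: mz => h [_ /= gh [l [hl l0]]].
  by rewrite gh in gz; rewrite (vconv_uniq aw naw hl gz) eqxx in l0.
(* The zeros in S alone suffice, each counted at least once. *)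
exists [seq (z, m z) | z <- S]; split.
- by rewrite -map_comp map_id.
- by move=> _ /mapP[z zS ->] /=; split; [case: (zeroS z zS) | case: (mP z zS)].
- rewrite big_map -sum1_size !big_seq; apply: leq_sum => z zS.
  by case: (mP z zS).
Qed.
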